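(* Let $m$ be a positive integer and $b:\mathbb{Z}_{\geq0}\to\mathbb{Z}$. The sequence $\{C_n^b \bmod m\}_{n\ge0}$ is eventually periodic if and only if $m\mid b(0)b(1)\cdots b(k)$ for some positive integer $k$.
   Context: A Dyck path of semilength $n$ is a sequence of lattice points $(0,0)=(x_0,y_0),\dots,(x_{2n},y_{2n})=(2n,0)$ with all $y_i\ge0$ and each step equal to $(1,1)$ or $(1,-1)$. An up-step starting at height $y$ has weight $b(y)$, a down-step has weight $1$, and a path's weight is the product of its step weights. The weighted Catalan number $C_n^b$ is the sum of the weights of all Dyck paths of semilength $n$ (so $C_0^b=1$). *)

(* Defs.v *)
From HB Require Import structures.
From mathcomp Require Import all_boot all_order all_algebra.
Set Implicit Arguments.
Unset Strict Implicit.
Unset Printing Implicit Defensive.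
Import Order.TTheory GRing.Theory Num.Theory.
Local Open Scope ring_scope.

Definition up_step : int * int := (1, 1).
Definition down_step : int * int := (1, -1).

Definition lattice_step (q r : int * int) : bool :=
  (r - q == up_step) || (r - q == down_step).

Definition is_dyck_path (n : nat) (p : seq (int * int)) : bool :=
  [&& size p == n.*2.+1, nth 0 p 0 == (0, 0), nth 0 p n.*2 == (n.*2%:Z, 0),
      all (fun q => 0 <= q.2) p & sorted lattice_step p].

(* On a Dyck path every height is nonnegative, so `|_| only converts it to
   a natural number. *)
Definition step_weight (b : nat -> int) (q r : int * int) : int :=
  if r - q == up_step then b `|q.2|%N else 1.

Definition path_weight (b : nat -> int) (p : seq (int * int)) : int :=
  \prod_(i < (size p).-1) step_weight b (nth 0 p i) (nth 0 p i.+1).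

Definition points_of (s : seq bool) : seq (int * int) :=
  0 :: scanl +%R 0 [seq (if u then up_step else down_step) | u <- s].

(* Steps are enumerated instead of points because they range over a finite
   type; mem_dyck_paths and uniq_dyck_paths show that every Dyck path occurs
   exactly once. *)
Definition dyck_paths (n : nat) : seq (seq (int * int)) :=
  [seq p <- [seq points_of s | s : (n.*2).-tuple bool] | is_dyck_path n p].

Definition weighted_catalan (b : nat -> int) (n : nat) : int :=
  \sum_(p <- dyck_paths n) path_weight b p.

Definition eventually_periodic (T : Type) (u : nat -> T) : Prop :=
  exists N t : nat, (0 < t)%N /\ forall n, (N <= n)%N -> u (n + t)%N = u n.

Lemma scanl_steps_inj (x : int * int) (s t : seq bool) :
  scanl +%R x [seq (if u then up_step else down_step) | u <- s] =
  scanl +%R x [seq (if u then up_step else down_step) | u <- t] -> s = t.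
Proof.
elim: s x t => [|u s IHs] x [|v t] //= /eqP; rewrite eqseq_cons.
by case/andP=> /eqP/addrI; case: u; case: v => // _ /eqP/IHs->.
Qed.

Lemma path_steps (x : int * int) (p : seq (int * int)) :
  path lattice_step x p ->
  exists2 s : seq bool, size s = size p &
    p = scanl +%R x [seq (if u then up_step else down_step) | u <- s].
Proof.
elim: p x => [|y p IHp] x /=; first by exists [::].
case/andP=> xy /IHp[s sz def_p].
exists ((y - x == up_step) :: s) => /=; first by rewrite sz.
suff -> : x + (if y - x == up_step then up_step else down_step) = y.
  by rewrite -def_p.
by case/orP: xy => /eqP def_y; rewrite def_y ?eqxx /= -def_y addrC subrK.
Qed.

Lemma mem_dyck_paths (n : nat) (p : seq (int * int)) :
  (p \in dyck_paths n) = is_dyck_path n p.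
Proof.
rewrite mem_filter andb_idr // => /and5P[].
case: p => // x p /eqP[sz_p] /eqP /= -> _ _ /path_steps[s sz_s ->].
have /eqP sz : size s = n.*2 by rewrite sz_s.
by apply/imageP; exists (Tuple sz).
Qed.

Lemma uniq_dyck_paths (n : nat) : uniq (dyck_paths n).
Proof.
rewrite filter_uniq // map_inj_uniq ?enum_uniq // => s t [] /scanl_steps_inj.
exact: val_inj.
Qed.

(* Main.v *)
(** Multiply the weight of the paths that go from height [h] to height [0] in
    [n] steps by [b 0 * ... * b (h - 1)].  The product [c n h] satisfies
    [c n (h + 2) = c (n + 1) (h + 1) - b h * c n h], so the column [c _ 0],
    which contains the weighted Catalan numbers, determines all columns without
    any division.  If the column [c _ 0] has period [T] modulo [m] from [N] on,
    then so has every column; since [c N (N + T) = 0] and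
    [c (N + T) (N + T) = b 0 * ... * b (N + T - 1)], this product is divisible
    by [m].  Conversely, if [m] divides [b 0 * ... * b k], then [c n h] vanishes
    modulo [m] for [h > k], and the first [k + 1] columns modulo [m] evolve
    deterministically in a finite set of states. *)
Require Import Defs.
From mathcomp Require Import all_boot all_order all_algebra.
From mathcomp Require Import ring.
Import Order.TTheory GRing.Theory Num.Theory.
Local Open Scope ring_scope.

(** * Path sums by the first step *)

Fixpoint ground_weight (b : nat -> int) (n h : nat) : int :=
  match n, h with
  | 0, 0 => 1
  | 0, _.+1 => 0
  | n'.+1, 0 => b 0 * ground_weight b n' 1
  | n'.+1, h'.+1 => b h * ground_weight b n' h.+1 + ground_weight b n' h'
  end.

Definition scaled_weight (b : nat -> int) (n h : nat) : int :=
  (\prod_(0 <= i < h) b i) * ground_weight b n h.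

Definition points_from (x : int * int) (s : seq bool) : seq (int * int) :=
  x :: scanl +%R x [seq (if u then up_step else down_step) | u <- s].

(** What remains of the Dyck condition once a path from the origin is given by its steps: they are
    legal by construction, and their number fixes the final abscissa. *)
Definition grounded (x : int * int) (s : seq bool) : bool :=
  all (fun q : int * int => 0 <= q.2) (points_from x s) &&
  ((last x (points_from x s)).2 == 0).

Lemma sorted_points_from x s : sorted lattice_step (points_from x s).
Proof.
rewrite /points_from /=; elim: s x => //= u s IHs x.
by rewrite IHs andbT /lattice_step addrAC subrr add0r; case: u; rewrite eqxx ?orbT.
Qed.

Lemma last_points_from1 x s :
  (last x (points_from x s)).1 = x.1 + (size s)%:Z.
Proof.
rewrite /points_from /=; elim: s x => [|u s IHs] x /=; first by rewrite addr0.
by rewrite IHs intS addrA; case: u.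
Qed.

Lemma is_dyck_path_points n (s : (n.*2).-tuple bool) :
  is_dyck_path n (points_of s) = grounded 0 s.
Proof.
rewrite /is_dyck_path -[points_of s]/(points_from 0 s) sorted_points_from andbT.
have sz : size (points_from 0 s) = n.*2.+1.
  by rewrite /= size_scanl size_map size_tuple.
have -> : nth 0 (points_from 0 s) n.*2 = last 0 (points_from 0 s).
  by rewrite -nth_last sz.
rewrite sz !eqxx /= /grounded [RHS]andbC; congr (_ && _).
have := last_points_from1 0 s; rewrite size_tuple add0r /=.
by case: (last _ _) => y1 y2 /= ->; rewrite -pair_eqE /= eqxx.
Qed.

Lemma path_weight_cons b x y p :
  path_weight b (x :: y :: p) = step_weight b x y * path_weight b (y :: p).
Proof. by rewrite /path_weight /= big_ord_recl. Qed.

Lemma big_tuple_cons n (P : seq bool -> bool) (F : seq bool -> int) :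
  \sum_(s : n.+1.-tuple bool | P s) F s =
  \sum_(s : n.-tuple bool | P (true :: s)) F (true :: s) +
  \sum_(s : n.-tuple bool | P (false :: s)) F (false :: s).
Proof.
rewrite (reindex (fun us : bool * n.-tuple bool => cons_tuple us.1 us.2)) /=.
  rewrite -(pair_big_dep xpredT (fun u (s : n.-tuple bool) => P (u :: s))
     (fun u (s : n.-tuple bool) => F (u :: s))) /=.
  by rewrite big_bool.
exists (fun s : n.+1.-tuple bool => (thead s, [tuple of behead s])).
  by case=> u s _; congr (_, _); apply: val_inj.
by move=> s _; rewrite [RHS]tuple_eta; apply: val_inj.
Qed.

Lemma grounded_cons x u s :
  grounded x (u :: s) =
  (0 <= x.2) && grounded (x + if u then up_step else down_step) s.
Proof. by rewrite /grounded /= !andbA. Qed.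

Lemma path_weight_points_from_cons b x u s :
  path_weight b (points_from x (u :: s)) =
  (if u then b `|x.2|%N else 1) *
  path_weight b (points_from (x + if u then up_step else down_step) s).
Proof.
rewrite /points_from /= path_weight_cons /step_weight addrAC subrr add0r.
by case: u.
Qed.

(** Induction on the first step; the abscissa [z] is arbitrary because every step moves it, while
    the weights ignore it. *)
Lemma sum_path_weight b n (z : int) h :
  \sum_(s : n.-tuple bool | grounded (z, h%:Z) s)
    path_weight b (points_from (z, h%:Z) s) = ground_weight b n h.
Proof.
elim: n h z => [|n IHn] h z.
  rewrite big_mkcond (big_pred1 [tuple]) => [|s]; last by apply/esym/eqP; exact: tuple0.
  by rewrite /grounded /path_weight big_ord0 /=; case: h.
rewrite (big_tuple_cons _ (grounded (z, h%:Z))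
  (fun s => path_weight b (points_from (z, h%:Z) s))).
under eq_bigl do rewrite grounded_cons /=.
under eq_bigr do rewrite path_weight_points_from_cons /=.
rewrite -big_distrr /=.
have -> : (z, h%:Z) + up_step = (z + 1, h.+1%:Z).
  by rewrite -add1n addnC PoszD.
rewrite IHn.
under [X in _ + X]eq_bigl do rewrite grounded_cons /=.
under [X in _ + X]eq_bigr do rewrite path_weight_points_from_cons /= mul1r.
(* From height 0 a down-step goes below the axis, so that sum is empty. *)
case: h => [|h] /=; first by rewrite big_pred0 ?addr0 // => s; rewrite /grounded.
have -> : (z, h.+1%:Z) + down_step = (z + 1, h%:Z).
  by congr pair; rewrite /= -addn1 PoszD addrK.
by rewrite IHn.
Qed.

Lemma weighted_catalanE b n : weighted_catalan b n = ground_weight b n.*2 0.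
Proof.
rewrite /weighted_catalan /dyck_paths big_filter big_map big_enum_cond /=.
rewrite -(sum_path_weight b n.*2 0 0); apply: eq_bigl => s.
exact: is_dyck_path_points.
Qed.

(** * Recurrence and vanishing of the scaled weights *)

Lemma scaled_weight0 b n : scaled_weight b n 0 = ground_weight b n 0.
Proof. by rewrite /scaled_weight big_geq // mul1r. Qed.

Lemma scaled_weightS0 b n : scaled_weight b n.+1 0 = scaled_weight b n 1.
Proof. by rewrite scaled_weight0 /scaled_weight big_nat1. Qed.

(** After an up-step, its weight [b h.+1] completes the product belonging to height [h.+2]; after a
    down-step, the factor [b h] is left over. *)
Lemma scaled_weightSS b n h :
  scaled_weight b n.+1 h.+1 =
  scaled_weight b n h.+2 + b h * scaled_weight b n h.
Proof. rewrite /scaled_weight /= !big_nat_recr //=; ring. Qed.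

Lemma scaled_weight_small b n h : (n < h)%N -> scaled_weight b n h = 0.
Proof.
elim: n h => [|n IHn] [|h] //= nh; first by rewrite /scaled_weight mulr0.
by rewrite scaled_weightSS !IHn ?mulr0 ?addr0 // ltnW // ltnS ltnW.
Qed.

(** Only the path of [n] down-steps, of weight 1, descends from height [n] in [n] steps. *)
Lemma scaled_weight_diag b n : scaled_weight b n n = \prod_(0 <= i < n) b i.
Proof.
elim: n => [|n IHn]; first by rewrite /scaled_weight mulr1.
by rewrite scaled_weightSS IHn scaled_weight_small // add0r big_nat_recr //= mulrC.
Qed.

(** Every step changes the parity of the height. Column 0 thus vanishes at odd [n], so a period of
    the Catalan numbers doubles to a period of the column. *)
Lemma scaled_weight_odd b n h : odd (n + h) -> scaled_weight b n h = 0.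
Proof.
elim: n h => [|n IHn] [|h] //= o_nh; first by rewrite /scaled_weight mulr0.
  by rewrite scaled_weightS0 IHn // addn1 -[n in odd n.+1]addn0.
rewrite scaled_weightSS !IHn ?mulr0 ?addr0 //.
  by move: o_nh; rewrite addnS /= negbK.
by move: o_nh; rewrite !addnS /= negbK.
Qed.

(** * Periodicity modulo [m] *)

Section Modulo.

Variables (m : nat) (b : nat -> int).

Lemma scaled_weight_period N T :
    (forall n, (N <= n)%N ->
       (m%:Z %| scaled_weight b (n + T) 0 - scaled_weight b n 0)%Z) ->
  forall h n, (N <= n)%N ->
    (m%:Z %| scaled_weight b (n + T) h - scaled_weight b n h)%Z.
Proof.
move=> per0 h.
(* The recurrence has order two in [h], so two neighbouring columns go through the induction
   together. *)
suff [] : (forall n, (N <= n)%N ->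
    (m%:Z %| scaled_weight b (n + T) h - scaled_weight b n h)%Z) /\
  (forall n, (N <= n)%N ->
    (m%:Z %| scaled_weight b (n + T) h.+1 - scaled_weight b n h.+1)%Z) by [].
elim: h => [|h [IH0 IH1]]; split=> // n le_Nn.
  by rewrite -!scaled_weightS0 -addSn per0 // leqW.
have -> : scaled_weight b (n + T) h.+2 - scaled_weight b n h.+2 =
    (scaled_weight b (n.+1 + T) h.+1 - scaled_weight b n.+1 h.+1) -
    b h * (scaled_weight b (n + T) h - scaled_weight b n h).
  by rewrite addSn !scaled_weightSS; ring.
by apply: rpredB; [exact/IH1/leqW | exact/dvdz_mull/IH0].
Qed.

Lemma dvdz_prod_of_period N T : (0 < T)%N ->
    (forall n, (N <= n)%N ->
       (m%:Z %| scaled_weight b (n + T) 0 - scaled_weight b n 0)%Z) ->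
  (m%:Z %| \prod_(0 <= i < N + T) b i)%Z.
Proof.
(* In column [N + T], row [N + T] is on the diagonal and row [N] has too few steps to be nonzero. *)
move=> T_gt0 /scaled_weight_period/(_ (N + T)%N N (leqnn N)).
by rewrite scaled_weight_diag scaled_weight_small ?subr0 // -[ltnLHS]addn0 ltn_add2l.
Qed.

Variable k : nat.
Hypothesis dvd_k : (m%:Z %| \prod_(0 <= i < k.+1) b i)%Z.

Lemma dvdz_scaled_weight n h : (k < h)%N -> (m%:Z %| scaled_weight b n h)%Z.
Proof.
move=> lt_kh; rewrite /scaled_weight (big_cat_nat (n := k.+1)) //= -mulrA.
exact: dvdz_mulr.
Qed.

(** The recurrence leaves the columns up to [k] only through column [k.+1], which vanishes modulo
    [m]. *)
Lemma scaled_weight_step i j :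
    (forall h, (h <= k)%N ->
       (m%:Z %| scaled_weight b i h - scaled_weight b j h)%Z) ->
  forall h, (h <= k)%N ->
    (m%:Z %| scaled_weight b i.+1 h - scaled_weight b j.+1 h)%Z.
Proof.
move=> eq_k.
have eq_ij h : (m%:Z %| scaled_weight b i h - scaled_weight b j h)%Z.
  by case: (leqP h k) => [/eq_k // | lt_kh]; rewrite rpredB // dvdz_scaled_weight.
move=> [|h] _; first by rewrite !scaled_weightS0.
rewrite !scaled_weightSS opprD addrACA -(mulrBr (b h)).
by apply: rpredD; [exact: eq_ij | exact/dvdz_mull/eq_ij].
Qed.

Lemma scaled_weight_ultimately_periodic : (0 < m)%N ->
  exists N T, (0 < T)%N /\ forall n, (N <= n)%N ->
    (m%:Z %| scaled_weight b (n + T) 0 - scaled_weight b n 0)%Z.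
Proof.
case: m dvd_k scaled_weight_step => // m' _ step _.
set M : int := m'.+1%:Z in step *.
pose residue (z : int) : 'I_m'.+1 := inord `|(z %% M)%Z|%N.
have residue_eq y z : residue y = residue z -> (M %| y - z)%Z.
  move=> /(congr1 (@nat_of_ord _)); rewrite !inordK; last 2 first.
  - by rewrite -ltz_nat gez0_abs ?modz_ge0 // ltz_pmod.
  - by rewrite -ltz_nat gez0_abs ?modz_ge0 // ltz_pmod.
  move/(congr1 Posz); rewrite !gez0_abs ?modz_ge0 // => /eqP.
  by rewrite eqz_mod_dvd.
pose state (n : nat) := [ffun h : 'I_k.+1 => residue (scaled_weight b n h)].
(* One more index than there are states, so two rows share a state. *)
pose f (n : 'I_(#|{ffun 'I_k.+1 -> 'I_m'.+1}|.+1)) := state n.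
have [i [j [lt_ij eq_ij]]] : exists i j, (i < j)%N /\ state i = state j.
  have /injectivePn[i [j neq_ij eq_ij]] : ~~ injectiveb f.
    by apply/negP=> /injectiveP/leq_card; rewrite card_ord ltnn.
  by case: (ltngtP i j) => [lt_ij | lt_ji | /val_inj/eqP];
    [exists i, j | exists j, i | rewrite (negPf neq_ij)].
(* Determinism carries the coincidence of rows [i] and [j] to all later rows. *)
have shift l h : (h <= k)%N ->
    (M %| scaled_weight b (l + j) h - scaled_weight b (l + i) h)%Z.
  elim: l h => [|l IHl] h; last exact: step.
  rewrite -ltnS => lt_hk; apply: residue_eq.
  by have /ffunP/(_ (Ordinal lt_hk)) := eq_ij; rewrite !ffunE.
exists i, (j - i)%N; rewrite subn_gt0; split=> // n le_in.
by rewrite addnBA ?(ltnW lt_ij) // -addnBAC // -{2}(subnK le_in) shift.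
Qed.

End Modulo.

Theorem theorem4p2 (m : nat) (b : nat -> int) (m_gt0 : (0 < m)%N) :
  eventually_periodic (fun n : nat => (weighted_catalan b n %% m%:Z)%Z) <->
  exists k : nat, (0 < k)%N /\ (m%:Z %| \prod_(0 <= i < k.+1) b i)%Z.
Proof.
have catE n : weighted_catalan b n = scaled_weight b n.*2 0.
  by rewrite weighted_catalanE scaled_weight0.
split=> [[N [t [t_gt0 per]]] | [k [_ dvd_k]]].
  have dvd : (m%:Z %| \prod_(0 <= i < N.*2 + t.*2) b i)%Z.
    apply: dvdz_prod_of_period => [|n]; first by rewrite double_gt0.
    have [o_n | e_n] := boolP (odd n) => le_Nn.
      by rewrite !scaled_weight_odd ?subrr ?addn0 // oddD odd_double addbF.
    rewrite -(even_halfK e_n) -doubleD -!catE -eqz_mod_dvd; apply/eqP/per.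
    by rewrite -leq_double even_halfK.
  (* This witness is positive because [t.*2] is at least 2. *)
  exists (N.*2 + t.*2).-1; rewrite prednK; last by rewrite addn_gt0 !double_gt0 t_gt0 orbT.
  by split=> //; case: t t_gt0 {per dvd} => // t _; rewrite doubleS !addnS.
have [N [T [T_gt0 per]]] := scaled_weight_ultimately_periodic _ _ _ dvd_k m_gt0.
exists N, T; split=> // n le_Nn; rewrite !catE.
have le_N2 : (N <= n.*2)%N by rewrite -addnn (leq_trans le_Nn) ?leq_addr.
apply/eqP; rewrite eqz_mod_dvd doubleD -(addnn T) addnA.
(* [T] counts single steps and may be odd; used twice, it shifts the semilength by [T]. *)
have := rpredD (per _ (leq_trans le_N2 (leq_addr T _))) (per _ le_N2).
by rewrite subrKA.
Qed.
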